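(* Let $A$ be a unital Banach algebra with identity element $I$, and let $(C(n))_{n\in\mathbb{Z}}$ be a discrete cosine family in $A$. If $\limsup_{n\to\infty}\|C(n)-I\|<\frac{3}{2}$, then $C(n)=I$ for all $n\in\mathbb{Z}$.
   Context: A discrete cosine family (also called a cosine sequence) in a unital algebra $A$ with identity element $I$ is a family $(C(n))_{n\in\mathbb{Z}}$ of elements of $A$ such that $C(0)=I$ and $C(n+m)+C(n-m)=2C(n)C(m)$ for all $n,m\in\mathbb{Z}$. *)

(* Defs.v *)
From HB Require Import structures.
From mathcomp Require Import all_boot all_order all_algebra.
From mathcomp Require Import all_classical all_reals all_analysis.
From mathcomp Require Import complex.
Set Implicit Arguments.
Unset Strict Implicit.
Unset Printing Implicit Defensive.
Import Order.TTheory GRing.Theory Num.Theory.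
Import numFieldNormedType.Exports.
Local Open Scope ring_scope.

(* A unital Banach algebra: a Banach space with an associative, bilinear and
   submultiplicative product that has a two-sided identity.
   - The product is given by explicit operations because Hierarchy Builder
     rejects the join of [CompleteNormedModule] and [GRing.Algebra]: the join
     of [Num.SemiNormedZmodule] and [GRing.PzSemiRing] it needs would have to
     be declared before [Num.NumDomain], which inherits from both.
   - The normalization [`|1| = 1], which some authors include in the
     definition, is not required, and the zero algebra is allowed. *)
HB.mixin Record CompleteNormedModule_isBanachAlgebra (K : numFieldType) A
    & CompleteNormedModule K A := {
  banach_one : A ;
  banach_mul : A -> A -> A ;
  banach_mulA : forall x y z : A,
    banach_mul x (banach_mul y z) = banach_mul (banach_mul x y) z ;
  banach_mul1l : forall x : A, banach_mul banach_one x = x ;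
  banach_mul1r : forall x : A, banach_mul x banach_one = x ;
  banach_mulDl : forall x y z : A,
    banach_mul (x + y) z = banach_mul x z + banach_mul y z ;
  banach_mulDr : forall x y z : A,
    banach_mul x (y + z) = banach_mul x y + banach_mul x z ;
  banach_scaleAl : forall (a : K) (x y : A),
    a *: banach_mul x y = banach_mul (a *: x) y ;
  banach_scaleAr : forall (a : K) (x y : A),
    a *: banach_mul x y = banach_mul x (a *: y) ;
  banach_normM : forall x y : A, `|banach_mul x y| <= `|x| * `|y|
}.

#[short(type="banachAlgType")]
HB.structure Definition BanachAlgebra (K : numFieldType) :=
  {A of CompleteNormedModule K A & CompleteNormedModule_isBanachAlgebra K A}.

Definition discrete_cosine_family (K : numFieldType) (A : banachAlgType K)
    (C : int -> A) : Prop :=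
  C 0 = banach_one /\
  forall n m : int, C (n + m) + C (n - m) = 2%:R *: banach_mul (C n) (C m).

(* Main.v *)
Require Import Defs.
From HB Require Import structures.
From mathcomp Require Import all_boot all_order all_algebra.
From mathcomp Require Import all_classical all_reals all_analysis.
From mathcomp Require Import complex.
From mathcomp Require Import lra.
Set Implicit Arguments.
Unset Strict Implicit.
Unset Printing Implicit Defensive.
Import Order.TTheory GRing.Theory Num.Theory.
Import numFieldNormedType.Exports.
Local Open Scope ring_scope.

(** Write [d n = C n - 1].  The case [n = m] of the cosine equation is the
doubling formula [C (2n) = 2 (C n)^2 - 1], which in terms of [d] reads
[d (2n) = 4 d n + 2 (d n)^2] ([doubling_deviation]).  Hence
[4 |d n| <= |d (2n)| + 2 |d n|^2].  A limit superior below [3/2] gives some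
[s < 3/2] with [|d n| <= s] for all large [n], so that
[(4 - 2 s) |d n| <= |d (2n)|] with a factor [4 - 2 s > 1].  Repeated doubling
multiplies [|d n|] by arbitrarily large factors without ever exceeding [s],
which is only possible if [d n = 0] ([doubling_growth_eq0]).  Hence [C n = 1]
for all large [n], and the cosine equation [C (n + m) + C (n - m) = 2 C n C m]
with [n] large reduces to [2 = 2 C m], for every [m].

The constant [3/2] is the nonzero solution of [4 L = L + 2 L^2].

The real and the complex case differ only in where the norm takes its values,
so the argument is carried out for a real-valued function [N] on the algebra
that has the properties of a submultiplicative norm and is homogeneous for
natural multiples. *)

(** A limit superior is an infimum of suprema over tails; one of these suprema
is already below [c], and it serves as the bound. *)
Lemma limn_esup_lt_fin (R : realType) (u : nat -> R) (c : R) :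
  (limn_esup (fun n => (u n)%:E) < c%:E)%E ->
  exists s M, s < c /\ forall n, (M <= n)%N -> u n <= s.
Proof.
move=> /ereal_inf_lt[_ [V [M _ MV] <-]].
have uV n : (M <= n)%N ->
    ((u n)%:E <= ereal_sup [set (u k)%:E | k in V])%E.
  by move=> Mn; apply: ereal_sup_ubound; exists n => //; exact: MV.
case: ereal_sup uV => [s|//|] uV sc.
- by exists s, M; split => [|n /uV]; rewrite -?lte_fin -?lee_fin.
- by have := uV M (leqnn M).
Qed.

(** Linear growth of the factor is enough, and it passes through the
induction on [k] because [1 + (k + 1) e <= (1 + k e) (1 + e)]. *)
Lemma doubling_growth_eq0 (R : archiRealFieldType) (a : nat -> R) (e s : R)
    (M : nat) :
  0 < e -> (forall n, 0 <= a n) -> (forall n, (M <= n)%N -> a n <= s) ->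
  (forall n, (M <= n)%N -> (1 + e) * a n <= a n.*2) ->
  forall n, (M <= n)%N -> a n = 0.
Proof.
move=> e0 a0 as_ a2.
have growth k : forall n, (M <= n)%N -> (1 + k%:R * e) * a n <= s.
  elim: k => [|k IHk] n Mn; first by rewrite mul0r addr0 mul1r as_.
  have Mn2 : (M <= n.*2)%N by rewrite -addnn (leq_trans Mn)// leq_addr.
  apply: le_trans (IHk _ Mn2).
  have ke0 : 0 <= k%:R * e by rewrite mulr_ge0// ltW.
  apply: (@le_trans _ _ ((1 + k%:R * e) * ((1 + e) * a n))).
    rewrite mulrA ler_wpM2r// -natr1.
    have := mulr_ge0 ke0 (ltW e0); nra.
  by rewrite ler_wpM2l ?a2// addr_ge0.
move=> n Mn; apply/eqP/contraT => an_neq0.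
have an0 : 0 < a n by rewrite lt0r an_neq0 a0.
have ea0 : 0 < e * a n by rewrite mulr_gt0.
have := growth (Num.bound (s / (e * a n))) n Mn.
have s0 : 0 <= s by rewrite (le_trans (a0 n)) ?as_.
have := archi_boundP (divr_ge0 s0 (ltW ea0)).
rewrite ltr_pdivrMr// => sb bs.
suff : s < s by rewrite ltxx.
by apply: lt_le_trans bs; rewrite mulrDl mul1r -mulrA ltr_wpDl.
Qed.

Section CosineFamily.
Variables (K : numFieldType) (A : banachAlgType K) (C : int -> A).
Hypothesis cosC : discrete_cosine_family C.

Lemma doubling_deviation (n : nat) :
  C n.*2 - banach_one = (C n - banach_one) *+ 4
    + banach_mul (C n - banach_one) (C n - banach_one) *+ 2.
Proof.
have [C0 CD] := cosC.
have -> : C n.*2 = banach_mul (C n) (C n) *+ 2 - banach_one.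
  by have := CD n n; rewrite subrr C0 -PoszD addnn scaler_nat => <-;
    rewrite addrK.
move: (C n - banach_one) (subrK banach_one (C n)) => d <-.
rewrite banach_mulDl !banach_mulDr !banach_mul1l banach_mul1r.
rewrite -addrA -opprD -mulr2n -mulrnBl addrA addrK -addrA addrC mulrnDl.
by rewrite -mulr2n -mulrnA.
Qed.

(** Taking [n] so large that [C n = C (n + m) = C (n - m) = 1] turns the cosine
equation into [2 = 2 C m]. *)
Lemma cosine_eventually_one (M : nat) :
  (forall n : nat, (M <= n)%N -> C n = banach_one) ->
  forall m : int, C m = banach_one.
Proof.
have [_ CD] := cosC => C1 m.
have C1z (k : int) : M%:Z <= k -> C k = banach_one.
  by case: k => // k /C1.
have Cm1 : 2%:R *: C m = 2%:R *: banach_one.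
  have := CD (M%:Z + `|m|) m.
  rewrite (C1z (_ + m)) ?(C1z (_ - m)) ?(C1z (_ + `|m|)).
  - by rewrite banach_mul1l => <-; rewrite scaler_nat mulr2n.
  - by rewrite lerDl.
  - by rewrite -addrA lerDl subr_ge0 ler_norm.
  - by rewrite -addrA lerDl -lerBlDr sub0r -normrN ler_norm.
by apply: scalerI Cm1; rewrite pnatr_eq0.
Qed.

Lemma cosine_three_halves (R : realType) (N : A -> R) :
  (forall x y, N (x + y) <= N x + N y) ->
  (forall x, N (- x) = N x) ->
  (forall x k, N (x *+ k) = N x *+ k) ->
  (forall x, N x = 0 -> x = 0) ->
  (forall x y, N (banach_mul x y) <= N x * N y) ->
  (limn_esup (fun n : nat => (N (C n%:Z - banach_one))%:E)
    < (3 / 2 : R)%:E)%E ->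
  forall n : int, C n = banach_one.
Proof.
move=> ND NN NMn N0 NM /limn_esup_lt_fin[s [M [s32 ds]]].
have N_ge0 x : 0 <= N x.
  have := ND x (- x); rewrite subrr NN -(mulr0n x) NMn mulr0n -mulr2n.
  by rewrite pmulrn_lge0.
apply: (@cosine_eventually_one M) => n Mn; apply/subr0_eq/N0.
(* The doubling factor is [4 - 2 s = 1 + (3 - 2 s)]. *)
move: n Mn; apply: (@doubling_growth_eq0 _ _ (3 - 2 * s) s) => //.
  by lra.
move=> n Mn; set d := C n - banach_one.
have dE : d *+ 4 = (C n.*2 - banach_one) - banach_mul d d *+ 2.
  by rewrite doubling_deviation addrK.
have := ND (C n.*2 - banach_one) (- (banach_mul d d *+ 2)).
rewrite -dE NN !NMn.
have := NM d d; have := ler_wpM2r (N_ge0 d) (ds n Mn : N d <= s).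
by rewrite -/d; lra.
Qed.

End CosineFamily.

(* Real Banach algebras, then complex ones; a norm over R[i] takes its values
   in R[i], so its real part is the norm as an element of R. *)
Theorem theorem2p9 (R : realType) :
  (forall (A : banachAlgType R) (C : int -> A),
     discrete_cosine_family C ->
     (limn_esup (fun n : nat => `|C n%:Z - banach_one|%:E) < (3 / 2 : R)%:E)%E ->
     forall n : int, C n = banach_one) /\
  (forall (A : banachAlgType R[i]) (C : int -> A),
     discrete_cosine_family C ->
     (limn_esup (fun n : nat => (complex.Re `|C n%:Z - banach_one|)%:E)
       < (3 / 2 : R)%:E)%E ->
     forall n : int, C n = banach_one).
Proof.
split=> A C cosC.
  apply: cosine_three_halves => //.
  - exact: ler_normD.
  - exact: normrN.
  - by move=> x k; rewrite normrMn.
  - by move=> x /normr0_eq0.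
  - exact: banach_normM.
have NE (x : A) : (complex.Re `|x|)%:C%C = `|x| by rewrite RRe_real ?normr_real.
apply: (@cosine_three_halves _ _ _ cosC _ (fun x => complex.Re `|x|)).
- by move=> x y; rewrite -lecR rmorphD /= !NE ler_normD.
- by move=> x; rewrite normrN.
- by move=> x k; rewrite normrMn raddfMn.
- by move=> x Nx0; apply/normr0_eq0; rewrite -NE Nx0.
- by move=> x y; rewrite -lecR rmorphM /= !NE banach_normM.
Qed.
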